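(* Let $W\subseteq\mathcal{L}_\Sigma$ be a finite set of formulas and $\varphi$ a formula in $\mathcal{L}_\Sigma$. Let $D_W=\{\delta_p\mid p\in\mathit{var}(W)\}$ and $D_\varphi=\{\delta_p\mid p\in\mathit{var}(\varphi)\setminus\mathit{var}(W)\}$, and consider the default theories $T=(D_W,W^\pm)$ and $T'=(D_W,W^\pm\cup c(D_\varphi))$. Write $D_W=\{\delta_1,\ldots,\delta_n\}$, let $G=\{g_1,\ldots,g_n\}$ be the indexed set of globally new variables corresponding to $D_W$, let $G'=\{g'_1,\ldots,g'_n\}$ be a further set of globally new variables, and let $$\Psi=\bigwedge_{i=1}^{n}\Big(\neg g'_i\to\exists G\big(\mathcal{E}xt[T]\wedge\neg\,\mathcal{C}onseq[T,c(\delta_i)]\big)\Big).$$ Then the paraconsistent signed consequence relations are axiomatised by QBFs as follows: 1. $W\vdash^\pm_c\varphi$ iff $\models\exists G(\mathcal{E}xt[T]\wedge\mathcal{C}onseq[T',\varphi^\pm])$; 2. $W\vdash^\pm_s\varphi$ iff $\models\neg\exists G(\mathcal{E}xt[T]\wedge\neg\,\mathcal{C}onseq[T',\varphi^\pm])$; and 3. $W\vdash^\pm_p\varphi$ iff $\models\neg\exists G'(\Psi\wedge\neg\,\mathcal{C}onseq_{G\leftarrow G'}[T',\varphi^\pm])$, where $\mathcal{C}onseq_{G\leftarrow G'}[T',\varphi^\pm]$ denotes the QBF obtained from $\mathcal{C}onseq[T',\varphi^\pm]$ by replacing each occurrence of an atom $g_i\in G$ by $g'_i$.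
   Context: Propositional language $\mathcal{L}_\Sigma$ over alphabet $\Sigma$; $\mathit{var}(\cdot)$ is the set of atoms occurring in a formula/set; $\mathrm{Cn}(\cdot)$ is classical deductive closure. $\Sigma^\pm=\{p^+,p^-\mid p\in\Sigma\}$ is a disjoint alphabet; for $\alpha\in\mathcal{L}_\Sigma$, $\alpha^\pm$ is obtained by replacing each positive occurrence of an atom $p$ by $p^+$ and each negative occurrence by $\neg p^-$ (likewise for sets). For each $p\in\Sigma$ the default $\delta_p$ has empty (tautological) prerequisite, justification $j(\delta_p)=(p^+\equiv\neg p^-)$, and consequent $c(\delta_p)=(p\equiv p^+)\wedge(\neg p\equiv p^-)$; for a set $D$ of defaults $j(D)$, $c(D)$ are the sets of justifications/consequents. With $D_\Sigma=\{\delta_p\mid p\in\Sigma\}$, $\mathcal{E}$ the set of Reiter extensions of $(D_\Sigma,W^\pm)$, and $\Pi_E=\{c(\delta_p)\mid p\in\Sigma,\ \neg j(\delta_p)\notin E\}$: $W\vdash^\pm_c\varphi$ iff $\varphi^\pm\in\bigcup_{E\in\mathcal{E}}\mathrm{Cn}(W^\pm\cup\Pi_E)$; $W\vdash^\pm_s\varphi$ iff $\varphi^\pm\in\bigcap_{E\in\mathcal{E}}\mathrm{Cn}(W^\pm\cup\Pi_E)$; $W\vdash^\pm_p\varphi$ iff $\varphi^\pm\in\mathrm{Cn}(W^\pm\cup\bigcap_{E\in\mathcal{E}}\Pi_E)$. QBF modules: for indexed sets $S=\{\phi_1,\ldots,\phi_n\}$, $R=\{\psi_1,\ldots,\psi_n\}$,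 $S\le R$ abbreviates $\bigwedge_{i=1}^n(\phi_i\to\psi_i)$. For finite sets $T_0$ and $S=\{\phi_1,\ldots,\phi_n\}$ with associated variables $G=\{g_1,\ldots,g_n\}$, $\mathcal{C}[T_0,S]=\exists P\,(T_0\wedge(G\le S))$ where $P=\mathit{var}(S\cup T_0)$. For a default theory $T=(D,V)$ with $D=\{\delta_1,\ldots,\delta_n\}$ and associated new variables $g_1,\ldots,g_n$: $\mathcal{E}xt[T]=\mathcal{C}[V,j(D)]\wedge\bigwedge_{i=1}^n\big(\neg g_i\to\neg\,\mathcal{C}[V\cup\{j(\delta_i)\},j(D\setminus\{\delta_i\})]\big)$, and $\mathcal{C}onseq[T,\varphi]=\forall P\big(V\wedge(G\le c(D))\to\varphi\big)$ where $P$ is the set of atoms occurring in $T$ or $\varphi$. *)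

(* Defs.v *)
From HB Require Import structures.
From mathcomp Require Import all_boot.

Set Implicit Arguments.
Unset Strict Implicit.
Unset Printing Implicit Defensive.

(* There are no truth constants: if falsum could occur in W, the signed theory *)
(* would not always be satisfiable. Equivalence is an abbreviation, so that every *)
(* atom occurrence has exactly one polarity.                                   *)
Inductive form (A : Type) : Type :=
| Var of A
| Not of form A
| And of form A & form A
| Or of form A & form A
| Imp of form A & form A.

Definition Iff (A : Type) (f g : form A) : form A := And (Imp f g) (Imp g f).

Fixpoint var (A : Type) (f : form A) : seq A :=
  match f with
  | Var a => [:: a]
  | Not f => var f
  | And f g | Or f g | Imp f g => var f ++ var g
  end.

Definition vars (A : Type) (S : seq (form A)) : seq A :=
  flatten [seq var f | f <- S].

Definition fset (A : Type) := form A -> Prop.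

Fixpoint set_of_seq (A : Type) (S : seq (form A)) : fset A :=
  fun f => if S is g :: S' then f = g \/ set_of_seq S' f else False.
Definition unionf (A : Type) (S S' : fset A) : fset A := fun f => S f \/ S' f.
Definition addf (A : Type) (S : fset A) (g : form A) : fset A :=
  fun f => f = g \/ S f.

Inductive derives (A : Type) : fset A -> form A -> Prop :=
| DHyp S f : S f -> derives S f
| DImpI S f g : derives (addf S f) g -> derives S (Imp f g)
| DImpE S f g : derives S (Imp f g) -> derives S f -> derives S g
| DAndI S f g : derives S f -> derives S g -> derives S (And f g)
| DAndE1 S f g : derives S (And f g) -> derives S f
| DAndE2 S f g : derives S (And f g) -> derives S g
| DOrI1 S f g : derives S f -> derives S (Or f g)
| DOrI2 S f g : derives S g -> derives S (Or f g)
| DOrE S f g h : derives S (Or f g) -> derives (addf S f) h ->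
    derives (addf S g) h -> derives S h
| DNotI S f g : derives (addf S f) g -> derives (addf S f) (Not g) ->
    derives S (Not f)
| DNotNotE S f : derives S (Not (Not f)) -> derives S f.

Definition Cn (A : Type) (S : fset A) : fset A := fun f => derives S f.

(* [pre d = None] is the empty (tautological) prerequisite.                    *)
Record default (A : Type) : Type := Default {
  pre : option (form A);
  jus : form A;
  con : form A
}.

Definition opt_in (A : Type) (S : fset A) (o : option (form A)) : Prop :=
  if o is Some f then S f else True.

(* Closure conditions of Reiter's operator Gamma at the context E.             *)
Definition reiter_closed (A : Type) (D : default A -> Prop) (V E S : fset A) :
    Prop :=
  [/\ forall f, V f -> S f,
      forall f, Cn S f -> S f
    & forall d, D d -> opt_in S (pre d) -> ~ E (Not (jus d)) -> S (con d)].

Definition Gamma (A : Type) (D : default A -> Prop) (V E : fset A) : fset A :=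
  fun f => forall S : fset A, reiter_closed D V E S -> S f.

Definition extension (A : Type) (D : default A -> Prop) (V E : fset A) : Prop :=
  forall f, E f <-> Gamma D V E f.

(* The alphabet Sigma together with its signed copies p^+ and p^-.             *)
Inductive satom (Sigma : Type) : Type :=
| Orig of Sigma
| Plus of Sigma
| Minus of Sigma.

Definition satom_code (Sigma : Type) (a : satom Sigma) : Sigma + (Sigma + Sigma) :=
  match a with
  | Orig p => inl p
  | Plus p => inr (inl p)
  | Minus p => inr (inr p)
  end.
Definition satom_decode (Sigma : Type) (a : Sigma + (Sigma + Sigma)) : satom Sigma :=
  match a with
  | inl p => Orig p
  | inr (inl p) => Plus p
  | inr (inr p) => Minus p
  end.
Lemma satom_codeK (Sigma : Type) :
  cancel (@satom_code Sigma) (@satom_decode Sigma).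
Proof. by case. Qed.
HB.instance Definition _ (Sigma : eqType) :=
  Equality.copy (satom Sigma) (can_type (@satom_codeK Sigma)).

(* [pol] is the polarity of the current subformula.                            *)
Fixpoint signed_at (Sigma : Type) (pol : bool) (f : form Sigma) :
    form (satom Sigma) :=
  match f with
  | Var p => if pol then Var (Plus p) else Not (Var (Minus p))
  | Not f => Not (signed_at (~~ pol) f)
  | And f g => And (signed_at pol f) (signed_at pol g)
  | Or f g => Or (signed_at pol f) (signed_at pol g)
  | Imp f g => Imp (signed_at (~~ pol) f) (signed_at pol g)
  end.

Definition signed (Sigma : Type) (f : form Sigma) : form (satom Sigma) :=
  signed_at true f.
Definition signed_seq (Sigma : Type) (W : seq (form Sigma)) :
    seq (form (satom Sigma)) := [seq signed f | f <- W].

Definition delta (Sigma : Type) (p : Sigma) : default (satom Sigma) :=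
  {| pre := None;
     jus := Iff (Var (Plus p)) (Not (Var (Minus p)));
     con := And (Iff (Var (Orig p)) (Var (Plus p)))
                (Iff (Not (Var (Orig p))) (Var (Minus p))) |}.

Definition D_all (Sigma : Type) : default (satom Sigma) -> Prop :=
  fun d => exists p : Sigma, d = delta p.

Definition signed_ext (Sigma : Type) (W : seq (form Sigma))
    (E : fset (satom Sigma)) : Prop :=
  extension (@D_all Sigma) (set_of_seq (signed_seq W)) E.

Definition Pi (Sigma : Type) (E : fset (satom Sigma)) : fset (satom Sigma) :=
  fun f => exists p : Sigma, f = con (delta p) /\ ~ E (Not (jus (delta p))).

Definition cred_conseq (Sigma : Type) (W : seq (form Sigma)) (f : form Sigma) :
    Prop :=
  exists E, signed_ext W E /\
    Cn (unionf (set_of_seq (signed_seq W)) (Pi E)) (signed f).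

Definition skep_conseq (Sigma : Type) (W : seq (form Sigma)) (f : form Sigma) :
    Prop :=
  forall E, signed_ext W E ->
    Cn (unionf (set_of_seq (signed_seq W)) (Pi E)) (signed f).

Definition prud_conseq (Sigma : Type) (W : seq (form Sigma)) (f : form Sigma) :
    Prop :=
  Cn (unionf (set_of_seq (signed_seq W))
             (fun g => forall E, signed_ext W E -> Pi E g)) (signed f).

Inductive qbf (A : Type) : Type :=
| qTop
| qVar of A
| qNot of qbf A
| qAnd of qbf A & qbf A
| qOr of qbf A & qbf A
| qImp of qbf A & qbf A
| qEx of A & qbf A
| qAll of A & qbf A.
Arguments qTop {A}.

Definition upd (A : eqType) (v : A -> bool) (a : A) (b : bool) : A -> bool :=
  fun x => if x == a then b else v x.

Fixpoint qeval (A : eqType) (v : A -> bool) (q : qbf A) : bool :=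
  match q with
  | qTop => true
  | qVar a => v a
  | qNot q => ~~ qeval v q
  | qAnd q r => qeval v q && qeval v r
  | qOr q r => qeval v q || qeval v r
  | qImp q r => qeval v q ==> qeval v r
  | qEx a q => qeval (upd v a true) q || qeval (upd v a false) q
  | qAll a q => qeval (upd v a true) q && qeval (upd v a false) q
  end.

Definition qvalid (A : eqType) (q : qbf A) : Prop := forall v, qeval v q.

(* Applied to free and bound atoms alike.                                      *)
Fixpoint qrename (A B : Type) (h : A -> B) (q : qbf A) : qbf B :=
  match q with
  | qTop => qTop
  | qVar a => qVar (h a)
  | qNot q => qNot (qrename h q)
  | qAnd q r => qAnd (qrename h q) (qrename h r)
  | qOr q r => qOr (qrename h q) (qrename h r)
  | qImp q r => qImp (qrename h q) (qrename h r)
  | qEx a q => qEx (h a) (qrename h q)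
  | qAll a q => qAll (h a) (qrename h q)
  end.

Definition qconj (A : Type) (s : seq (qbf A)) : qbf A := foldr (@qAnd A) qTop s.
Definition qexs (A : Type) (s : seq A) (q : qbf A) : qbf A := foldr (@qEx A) q s.
Definition qalls (A : Type) (s : seq A) (q : qbf A) : qbf A :=
  foldr (@qAll A) q s.

(* The alphabet A extended by the new variables g_i and g'_i.                  *)
Inductive gatom (A : Type) : Type :=
| Base of A
| Guess of nat
| Guess' of nat.
Arguments Guess {A} _.
Arguments Guess' {A} _.

Definition gatom_code (A : Type) (a : gatom A) : A + (nat + nat) :=
  match a with
  | Base p => inl p
  | Guess i => inr (inl i)
  | Guess' i => inr (inr i)
  end.
Definition gatom_decode (A : Type) (a : A + (nat + nat)) : gatom A :=
  match a with
  | inl p => Base p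
  | inr (inl i) => Guess i
  | inr (inr i) => Guess' i
  end.
Lemma gatom_codeK (A : Type) : cancel (@gatom_code A) (@gatom_decode A).
Proof. by case. Qed.
HB.instance Definition _ (A : eqType) :=
  Equality.copy (gatom A) (can_type (@gatom_codeK A)).

Fixpoint qform (A : Type) (f : form A) : qbf (gatom A) :=
  match f with
  | Var a => qVar (Base a)
  | Not f => qNot (qform f)
  | And f g => qAnd (qform f) (qform g)
  | Or f g => qOr (qform f) (qform g)
  | Imp f g => qImp (qform f) (qform g)
  end.

(* A finite set of formulas, read as the conjunction of its elements.          *)
Definition qset (A : Type) (S : seq (form A)) : qbf (gatom A) :=
  qconj [seq qform f | f <- S].

Definition qle (A : Type) (S R : seq (qbf A)) : qbf A :=
  qconj [seq qImp x.1 x.2 | x <- zip S R].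

Definition qatoms (A : eqType) (s : seq A) : seq (gatom A) :=
  [seq Base a | a <- undup s].

Definition C_mod (A : eqType) (T0 S : seq (form A)) (G : seq (gatom A)) :
    qbf (gatom A) :=
  qexs (qatoms (vars (S ++ T0)))
    (qAnd (qset T0) (qle [seq qVar g | g <- G] [seq qform f | f <- S])).

(* Finite default theories with an indexed set of n defaults.                  *)
Record dtheory (A : Type) (n : nat) : Type := DTheory {
  dflt : 'I_n -> default A;
  facts : seq (form A)
}.

Definition guesses (A : Type) (n : nat) : seq (gatom A) :=
  [seq Guess (nat_of_ord i) | i <- enum 'I_n].
Definition guesses' (A : Type) (n : nat) : seq (gatom A) :=
  [seq Guess' (nat_of_ord i) | i <- enum 'I_n].

Definition Ext_mod (A : eqType) (n : nat) (T : dtheory A n) : qbf (gatom A) :=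
  qAnd
    (C_mod (facts T) [seq jus (dflt T i) | i <- enum 'I_n] (guesses A n))
    (qconj
       [seq qImp (qNot (qVar (Guess (nat_of_ord i))))
                 (qNot (C_mod (rcons (facts T) (jus (dflt T i)))
                    [seq jus (dflt T k) | k <- enum 'I_n & k != i]
                    [seq Guess (nat_of_ord k) | k <- enum 'I_n & k != i]))
       | i <- enum 'I_n]).

Definition default_var (A : Type) (d : default A) : seq A :=
  (if pre d is Some f then var f else [::]) ++ var (jus d) ++ var (con d).

Definition dtheory_var (A : Type) (n : nat) (T : dtheory A n) : seq A :=
  flatten [seq default_var (dflt T i) | i <- enum 'I_n] ++ vars (facts T).

Definition Conseq_mod (A : eqType) (n : nat) (T : dtheory A n) (f : form A) :
    qbf (gatom A) :=
  qalls (qatoms (dtheory_var T ++ var f))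
    (qImp (qAnd (qset (facts T))
                (qle [seq qVar g | g <- guesses A n]
                     [seq qform (con (dflt T i)) | i <- enum 'I_n]))
          (qform f)).

Definition prime_guess (A : Type) (a : gatom A) : gatom A :=
  if a is Guess i then Guess' i else a.

(* T = (D_W, W^+-) and T' = (D_W, W^+- u c(D_f)); p enumerates var(W).         *)
Definition thy (Sigma : Type) (n : nat) (p : 'I_n -> Sigma)
    (W : seq (form Sigma)) : dtheory (satom Sigma) n :=
  {| dflt := fun i => delta (p i); facts := signed_seq W |}.

Definition thy' (Sigma : eqType) (n : nat) (p : 'I_n -> Sigma)
    (W : seq (form Sigma)) (f : form Sigma) : dtheory (satom Sigma) n :=
  {| dflt := fun i => delta (p i);
     facts := signed_seq W ++
              [seq con (delta q) | q <- undup (var f) & q \notin vars W] |}.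

Definition Psi (A : eqType) (n : nat) (T : dtheory A n) : qbf (gatom A) :=
  qconj
    [seq qImp (qNot (qVar (Guess' (nat_of_ord i))))
              (qexs (guesses A n)
                 (qAnd (Ext_mod T) (qNot (Conseq_mod T (con (dflt T i))))))
    | i <- enum 'I_n].

(* Main.v *)
Require Import Defs.
From mathcomp Require Import all_boot.
From mathcomp Require Import boolp.

(** The defaults have no prerequisites, so E is an extension iff
    E = Cn(W^± ∪ Pi_E).  The justification of [delta q] is the part of its
    consequent that does not mention q itself, and a valuation satisfying the
    justification can be changed at q to satisfy the consequent; hence only the
    satisfiability of W^± with sets of justifications matters.  Moreover the
    default of an atom outside var(W) always applies, so extensions correspond
    to the maximal sets of defaults over var(W) whose justifications are
    jointly satisfiable with W^±, which is what [Ext_mod] expresses.  By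
    completeness of natural deduction, [Conseq_mod] then expresses derivability
    from W^± ∪ Pi_E.  For prudent consequence, [Psi] holds of G' iff G' contains
    every default common to all extensions; as entailment is monotone in G',
    quantifying over all such G' amounts to testing that intersection. *)

Set Implicit Arguments.
Unset Strict Implicit.
Unset Printing Implicit Defensive.

(** * Classical valuations; soundness and completeness of natural deduction *)

Fixpoint feval (A : Type) (v : A -> bool) (f : form A) : bool :=
  match f with
  | Var a => v a
  | Not f => ~~ feval v f
  | And f g => feval v f && feval v g
  | Or f g => feval v f || feval v g
  | Imp f g => feval v f ==> feval v g
  end.

Lemma eq_feval_in (A : eqType) (v w : A -> bool) (f : form A) :
  {in var f, v =1 w} -> feval v f = feval w f.
Proof.
elim: f => [a|f IH|f IHf g IHg|f IHf g IHg|f IHf g IHg] /= H;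
  try by rewrite IHf ?IHg // => x xf; apply: H; rewrite mem_cat xf ?orbT.
- by apply: H; rewrite inE.
- by rewrite IH.
Qed.

Lemma derives_mono (A : Type) (S S' : fset A) f :
  derives S f -> (forall g, S g -> S' g) -> derives S' f.
Proof.
move=> d; elim: d S' => {S f}.
- by move=> S f Sf S' H; apply: DHyp; apply: H.
- by move=> S f g _ IH S' H; apply: DImpI; apply: IH => h [->|/H]; [left|right].
- by move=> S f g _ IH1 _ IH2 S' H; apply: DImpE (IH1 _ H) (IH2 _ H).
- by move=> S f g _ IH1 _ IH2 S' H; apply: DAndI (IH1 _ H) (IH2 _ H).
- by move=> S f g _ IH S' H; apply: DAndE1 (IH _ H).
- by move=> S f g _ IH S' H; apply: DAndE2 (IH _ H).
- by move=> S f g _ IH S' H; apply: DOrI1 (IH _ H).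
- by move=> S f g _ IH S' H; apply: DOrI2 (IH _ H).
- move=> S f g h _ IH1 _ IH2 _ IH3 S' H; apply: DOrE (IH1 _ H) _ _.
  + by apply: IH2 => k [->|/H]; [left|right].
  + by apply: IH3 => k [->|/H]; [left|right].
- move=> S f g _ IH1 _ IH2 S' H; apply: (@DNotI _ _ _ g).
  + by apply: IH1 => k [->|/H]; [left|right].
  + by apply: IH2 => k [->|/H]; [left|right].
- by move=> S f _ IH S' H; apply: DNotNotE (IH _ H).
Qed.

Lemma derives_add (A : Type) (S : fset A) f g :
  derives S g -> derives (addf S f) g.
Proof. by move=> d; apply: derives_mono d _ => h; right. Qed.

Lemma derives_trans (A : Type) (S S' : fset A) f :
  derives S f -> (forall g, S g -> derives S' g) -> derives S' f.
Proof.
have ext (T T' : fset A) h : (forall g, T g -> derives T' g) ->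
    forall g, addf T h g -> derives (addf T' h) g.
  by move=> H g [->|/H/derives_add]; [apply: DHyp; left|apply].
move=> d; elim: d S' => {S f}.
- by move=> S f Sf S' H; apply: H.
- by move=> S f g _ IH S' H; apply/DImpI/IH/ext.
- by move=> S f g _ IH1 _ IH2 S' H; apply: DImpE (IH1 _ H) (IH2 _ H).
- by move=> S f g _ IH1 _ IH2 S' H; apply: DAndI (IH1 _ H) (IH2 _ H).
- by move=> S f g _ IH S' H; apply: DAndE1 (IH _ H).
- by move=> S f g _ IH S' H; apply: DAndE2 (IH _ H).
- by move=> S f g _ IH S' H; apply: DOrI1 (IH _ H).
- by move=> S f g _ IH S' H; apply: DOrI2 (IH _ H).
- move=> S f g h _ IH1 _ IH2 _ IH3 S' H.
  by apply: DOrE (IH1 _ H) (IH2 _ (ext _ _ _ H)) (IH3 _ (ext _ _ _ H)).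
- move=> S f g _ IH1 _ IH2 S' H.
  by apply: DNotI (IH1 _ (ext _ _ _ H)) (IH2 _ (ext _ _ _ H)).
- by move=> S f _ IH S' H; apply: DNotNotE (IH _ H).
Qed.

Lemma derives_sound (A : Type) (S : fset A) f (v : A -> bool) :
  derives S f -> (forall g, S g -> feval v g) -> feval v f.
Proof.
have ext (T : fset A) h : (forall g, T g -> feval v g) -> feval v h ->
    forall g, addf T h g -> feval v g by move=> H vh g [->|/H].
elim=> {S f} /=.
- by move=> S f Sf H; apply: H.
- by move=> S f g _ IH H; apply/implyP => vf; apply/IH/ext.
- by move=> S f g _ IH1 _ IH2 H; apply: (implyP (IH1 H)); apply: IH2.
- by move=> S f g _ IH1 _ IH2 H; rewrite IH1 ?IH2.
- by move=> S f g _ IH H; case/andP: (IH H).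
- by move=> S f g _ IH H; case/andP: (IH H).
- by move=> S f g _ IH H; rewrite IH.
- by move=> S f g _ IH H; rewrite IH ?orbT.
- by move=> S f g h _ IH1 _ IH2 _ IH3 H; case/orP: (IH1 H) => vf;
    [apply: IH2|apply: IH3]; apply: ext.
- move=> S f g _ IH1 _ IH2 H; apply/negP => vf.
  by have /negP := IH2 (ext _ _ H vf); apply; apply: IH1; apply: ext.
- by move=> S f _ IH H; rewrite -[feval v f]negbK; apply: IH.
Qed.

Lemma derives_explode (A : Type) (S : fset A) f g :
  derives S f -> derives S (Not f) -> derives S g.
Proof.
by move=> df dnf; apply/DNotNotE/(@DNotI _ _ _ f); apply: derives_add.
Qed.

(** Argue by contradiction: under [Not g] the first derivation refutes [f], and then the second one
    yields [g]. *)
Lemma derives_cases (A : Type) (S : fset A) f g :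
  derives (addf S f) g -> derives (addf S (Not f)) g -> derives S g.
Proof.
move=> d1 d2; apply/DNotNotE/(@DNotI _ _ _ g); last by apply: DHyp; left.
have dn : derives (addf S (Not g)) (Not f).
  apply: (@DNotI _ _ _ g); last by apply: DHyp; right; left.
  by apply: derives_mono d1 _ => h [->|Sh]; [left|right; right].
apply: DImpE (DImpI _) dn.
by apply: derives_mono d2 _ => h [->|Sh]; [left|right; right].
Qed.

Definition flip (A : Type) (b : bool) (f : form A) : form A :=
  if b then f else Not f.

(* Kalmar's lemma. *)
Lemma derives_flip (A : eqType) (S : fset A) (v : A -> bool) f :
  (forall a, a \in var f -> S (flip (v a) (Var a))) ->
  derives S (flip (feval v f) f).
Proof.
have inl (s t : seq A) : (forall a, a \in s ++ t -> S (flip (v a) (Var a))) ->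
    (forall a, a \in s -> S (flip (v a) (Var a))) /\
    (forall a, a \in t -> S (flip (v a) (Var a))).
  by move=> H; split=> a ain; apply: H; rewrite mem_cat ain ?orbT.
elim: f => [a|f IH|f IHf g IHg|f IHf g IHg|f IHf g IHg] /=.
- by move=> H; apply: DHyp; apply: H; rewrite inE.
- move=> /IH; case: (feval v f) => //= d.
  by apply: (@DNotI _ _ _ f); [apply: derives_add|apply: DHyp; left].
- move=> /inl[/IHf + /IHg]; case: (feval v f) => /= df.
    case: (feval v g) => /= dg; first exact: DAndI.
    apply: (@DNotI _ _ _ g); last exact: derives_add.
    by apply: (@DAndE2 _ _ f); apply: DHyp; left.
  move=> _; apply: (@DNotI _ _ _ f); last exact: derives_add.
  by apply: (@DAndE1 _ _ _ g); apply: DHyp; left.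
- move=> /inl[/IHf + /IHg]; case: (feval v f) => /= df.
    by move=> _; apply: DOrI1.
  case: (feval v g) => /= dg; first exact: DOrI2.
  apply: (@DNotI _ _ _ f); last exact: derives_add.
  apply: (@DOrE _ _ f g); first by apply: DHyp; left.
    by apply: DHyp; left.
  apply: (@derives_explode _ _ g); first by apply: DHyp; left.
  by apply: derives_add; apply: derives_add.
- move=> /inl[/IHf + /IHg]; case: (feval v f) => /= df; last first.
    move=> _; apply: DImpI; apply: (@derives_explode _ _ f).
      by apply: DHyp; left.
    exact: derives_add.
  case: (feval v g) => /= dg; first by apply: DImpI; apply: derives_add.
  apply: (@DNotI _ _ _ g); last exact: derives_add.
  by apply: DImpE (derives_add _ df); apply: DHyp; left.
Qed.

(** The literals are discharged one atom at a time by case distinction. The two cases use the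
    hypothesis at [v] updated at [a], so repetitions in [s] do no harm. *)
Lemma derives_atom_cases (A : eqType) (S : fset A) (s : seq A) f :
  (forall v : A -> bool, derives
     (unionf S (fun g => exists2 a, a \in s & g = flip (v a) (Var a))) f) ->
  derives S f.
Proof.
elim: s => [|a s IH] H.
  by apply: derives_mono (H xpredT) _ => g [//|[a]].
apply: IH => v; apply: (@derives_cases _ _ (Var a)).
- apply: derives_mono (H (upd v a true)) _ => g [Sg|[b bs ->]].
    by right; left.
  rewrite /upd; case: eqP => [->|ne]; first by left.
  right; right; exists b => //.
  by move: bs; rewrite inE => /orP[/eqP|].
- apply: derives_mono (H (upd v a false)) _ => g [Sg|[b bs ->]].
    by right; left.
  rewrite /upd; case: eqP => [->|ne]; first by left.
  right; right; exists b => //.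
  by move: bs; rewrite inE => /orP[/eqP|].
Qed.

Lemma all_set_of_seq (A : Type) (P : pred (form A)) (S : seq (form A)) :
  all P S <-> (forall f, set_of_seq S f -> P f).
Proof.
elim: S => [|g S IH] /=; first by split.
split=> [/andP[Pg /IH H] f [->|/H] //|H].
by rewrite H ?(IH.2 _) //; [move=> f Sf; apply: H; right|left].
Qed.

(** Under the literals of any [v], either [f] is true and hence derivable, or some [g] in [S] is
    false, so that [Not g] is derivable and contradicts [g]. The literals are then eliminated by
    cases. *)
Lemma derives_complete (A : eqType) (S : seq (form A)) f :
  (forall v, all (feval v) S -> feval v f) -> derives (set_of_seq S) f.
Proof.
move=> H; apply: (@derives_atom_cases _ _ (vars S ++ var f)) => v.
set U := unionf _ _.
have dflip g : {subset var g <= vars S ++ var f} -> derives U (flip (feval v g) g).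
  by move=> sub; apply: derives_flip => a /sub ain; right; exists a.
have [/H vf|allS] := boolP (all (feval v) S).
  have := dflip f; rewrite vf; apply.
  by move=> a af; rewrite mem_cat af orbT.
have [g [Sg nvg sub]] : exists g, [/\ set_of_seq S g, ~~ feval v g &
    {subset var g <= vars S}].
  elim: S allS {U dflip H} => [//|g S IH] /=.
  have [vg /= /IH[h [Sh nvh sub]]|vg _] := boolP (feval v g).
    exists h; split=> //; first by right.
    by move=> a /sub; rewrite /vars /= mem_cat => ->; rewrite orbT.
  by exists g; split; [left| |move=> a; rewrite /vars /= mem_cat => ->].
apply: (@derives_explode _ _ g); first by apply: DHyp; left.
have := dflip g; rewrite (negbTE nvg); apply.
by move=> a /sub; rewrite mem_cat => ->.
Qed.

(** * Reiter's operator for prerequisite-free defaults *)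

Lemma GammaE (A : Type) (D : default A -> Prop) (V E : fset A) f :
  (forall d, D d -> pre d = None) ->
  Gamma D V E f <-> derives
    (unionf V (fun g => exists2 d, D d /\ ~ E (Not (jus d)) & g = con d)) f.
Proof.
move=> Dpre; set U := unionf _ _; split=> [|d S [VS CnS DS]].
  apply; split=> [g Vg|g dg|d Dd _ nE].
  - by apply: DHyp; left.
  - exact: derives_trans dg _.
  - by apply: DHyp; right; exists d.
apply: CnS; apply: derives_mono d _ => g [/VS //|[d [Dd nE] ->]].
by apply: DS => //; rewrite Dpre.
Qed.

(** * Evaluation of quantifier blocks *)

Section QBFSemantics.
Variable A : eqType.
Implicit Types (v w : A -> bool) (q : qbf A).

Lemma eq_qeval v w q : v =1 w -> qeval v q = qeval w q.
Proof.
elim: q v w => //= [q IH|q IHq r IHr|q IHq r IHr|q IHq r IHr|a q IH|a q IH] v w vw;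
  try by rewrite (IHq v w) ?(IHr v w).
- by rewrite (IH v w).
- by congr orb; apply: IH => x; rewrite /upd vw.
- by congr andb; apply: IH => x; rewrite /upd vw.
Qed.

Lemma qeval_qAnd v q r : qeval v (qAnd q r) <-> qeval v q /\ qeval v r.
Proof. by split=> [/andP|/andP]. Qed.

Lemma qeval_qNot v q : qeval v (qNot q) <-> ~ qeval v q.
Proof. by split=> [/negP|/negP]. Qed.

Lemma qeval_qexs v (s : seq A) q :
  qeval v (qexs s q) <->
  exists2 w, (forall x, x \notin s -> w x = v x) & qeval w q.
Proof.
elim: s v => [|a s IH] v /=.
  split=> [vq|[w wv]]; first by exists v.
  by rewrite (@eq_qeval w v) // => x; apply: wv.
split=> [/orP[]/IH[w wv wq]|[w wv wq]].
- exists w => // x; rewrite inE negb_or => /andP[xa xs].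
  by rewrite wv // /upd (negbTE xa).
- exists w => // x; rewrite inE negb_or => /andP[xa xs].
  by rewrite wv // /upd (negbTE xa).
- have H : qeval (upd v a (w a)) (qexs s q).
    apply/IH; exists w => // x xs; rewrite /upd; case: eqP => [-> //|/eqP xa].
    by apply: wv; rewrite inE negb_or xa.
  by case: (w a) H => ->; rewrite ?orbT.
Qed.

Lemma qeval_qalls v (s : seq A) q :
  qeval v (qalls s q) <->
  forall w, (forall x, x \notin s -> w x = v x) -> qeval w q.
Proof.
have -> : qeval v (qalls s q) = ~~ qeval v (qexs s (qNot q)).
  by elim: s v => [|a s IH] v /=; rewrite ?negbK // !IH negb_or.
split=> [/negP H w wv|H]; first apply/negPn/negP => nwq.
  by apply: H; apply/qeval_qexs; exists w.
by apply/negP => /qeval_qexs[w wv /negP]; apply; apply: H.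
Qed.

Lemma qeval_qconj v (s : seq (qbf A)) : qeval v (qconj s) = all (qeval v) s.
Proof. by elim: s => //= q s ->. Qed.

End QBFSemantics.

(** * Semantic content of the QBF modules *)

Section Modules.
Variable A : eqType.
Implicit Types (v : A -> bool) (f : form A).

Lemma qeval_qform (w : gatom A -> bool) (f : form A) :
  qeval w (qform f) = feval (fun a => w (Base a)) f.
Proof. by elim: f => //= [f ->|f -> g ->|f -> g ->|f -> g ->]. Qed.

Lemma qeval_qset (w : gatom A -> bool) (S : seq (form A)) :
  qeval w (qset S) = all (feval (fun a => w (Base a))) S.
Proof.
by rewrite qeval_qconj all_map; apply: eq_all => f; rewrite /= qeval_qform.
Qed.

Lemma qeval_qle (I : Type) (w : gatom A -> bool) (s : seq I)
    (g : I -> gatom A) (r : I -> form A) :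
  qeval w (qle [seq qVar x | x <- [seq g i | i <- s]]
               [seq qform f | f <- [seq r i | i <- s]]) =
  all (fun i => w (g i) ==> feval (fun a => w (Base a)) (r i)) s.
Proof.
rewrite /qle -!map_comp qeval_qconj all_map.
by elim: s => //= i s ->; rewrite qeval_qform.
Qed.

(** Witness for a quantifier block over [s]: it carries a valuation of formulas while leaving the
    guesses as in [w]. *)
Definition overlay (s : seq A) (v : A -> bool) (w : gatom A -> bool) (x : gatom A) :=
  if x is Base a then if a \in s then v a else w x else w x.

Lemma overlay_notin s v w x : x \notin qatoms s -> overlay s v w x = w x.
Proof.
case: x => //= a; case: ifP => // sa; rewrite /qatoms.
by rewrite (map_f (@Base A)) // mem_undup.
Qed.

Lemma feval_overlay s v w (f : form A) : {subset var f <= s} ->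
  feval (fun a => overlay s v w (Base a)) f = feval v f.
Proof. by move=> sub; apply: eq_feval_in => a /sub /= ->. Qed.

Lemma all_overlay s v w (S : seq (form A)) :
  {subset vars S <= s} ->
  all (feval (fun a => overlay s v w (Base a))) S = all (feval v) S.
Proof.
elim: S => //= f S IH; rewrite /vars /= => sub.
by rewrite feval_overlay ?IH // => a af; apply: sub; rewrite mem_cat af ?orbT.
Qed.

Lemma var_sub_vars (I : eqType) (s : seq I) (r : I -> form A) i :
  i \in s -> {subset var (r i) <= vars [seq r j | j <- s]}.
Proof.
move=> si a ar; apply/flattenP; exists (var (r i)) => //.
by rewrite -map_comp; apply/mapP; exists i.
Qed.

Lemma vars_cat (S S' : seq (form A)) : vars (S ++ S') = vars S ++ vars S'.
Proof. by rewrite /vars map_cat flatten_cat. Qed.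

(** The block binds every atom of the formulas involved, so only the guesses of [w] matter. *)
Lemma qeval_C_mod (I : eqType) (w : gatom A -> bool) (T0 : seq (form A))
    (s : seq I) (g : I -> nat) (r : I -> form A) :
  qeval w (C_mod T0 [seq r i | i <- s] [seq Guess (g i) | i <- s]) <->
  exists2 v, all (feval v) T0 & {in s, forall i, w (Guess (g i)) -> feval v (r i)}.
Proof.
set P := vars ([seq r i | i <- s] ++ T0).
have PT : {subset vars T0 <= P} by move=> a; rewrite /P vars_cat mem_cat => ->; rewrite orbT.
have Pr i : i \in s -> {subset var (r i) <= P}.
  by move=> /(@var_sub_vars _ s r) sub a /sub; rewrite /P vars_cat mem_cat => ->.
rewrite /C_mod -/P; split=> [/qeval_qexs[w' w'w]|[v vT vr]].
  rewrite /= qeval_qset qeval_qle => /andP[wT /allP wr].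
  exists (fun a => w' (Base a)) => // i si wi; apply: (implyP (wr i si)).
  by rewrite w'w //; apply/mapP => -[].
apply/qeval_qexs; exists (overlay P v w); first exact: overlay_notin.
rewrite /= qeval_qset qeval_qle all_overlay // vT /=; apply/allP => i si.
by apply/implyP => /= wi; rewrite feval_overlay ?vr //; apply: Pr.
Qed.

(** Taking [jus] for [sel] gives the consistency test, taking [con] the consequence test. *)
Definition model n (T : dtheory A n) (g : 'I_n -> bool)
    (sel : default A -> form A) v :=
  all (feval v) (facts T) /\ forall i, g i -> feval v (sel (dflt T i)).

(** Maximality is stated one default at a time, as in [Ext_mod]; this amounts to maximality under
    inclusion, since subsets of a consistent choice are consistent. *)
Definition maxcons n (T : dtheory A n) (g : 'I_n -> bool) :=
  (exists v, model T g (@jus A) v) /\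
  forall i v, model T g (@jus A) v -> feval v (jus (dflt T i)) -> g i.

Definition guess_of n (w : gatom A -> bool) (i : 'I_n) := w (Guess (nat_of_ord i)).

Lemma qeval_Ext_mod n (T : dtheory A n) (w : gatom A -> bool) :
  qeval w (Ext_mod T) <-> maxcons T (guess_of w).
Proof.
rewrite /Ext_mod /= qeval_qconj all_map.
(* When the guess for [i] is false, removing [i] from the indexed family drops only a vacuous
   implication. *)
have step i : ~~ guess_of w i ->
  qeval w (C_mod (rcons (facts T) (jus (dflt T i)))
     [seq jus (dflt T k) | k <- enum 'I_n & k != i]
     [seq Guess (nat_of_ord k) | k <- enum 'I_n & k != i]) <->
  exists2 v, model T (guess_of w) (@jus A) v & feval v (jus (dflt T i)).
  move=> ngi; rewrite qeval_C_mod; split=> -[v].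
    rewrite all_rcons => /andP[vi vT] H; exists v => //; split=> // k gk.
    apply: (H k) (gk); rewrite mem_filter mem_enum andbT.
    by apply: contraNneq ngi => <-; exact: gk.
  move=> [vT H] vi; exists v; first by rewrite all_rcons vi.
  by move=> k _; apply: H.
split=> [/andP[/qeval_C_mod[v vT vj] /allP H]|[[v [vT vj]] H]].
  split; first by exists v; split=> // i gi; apply: vj; rewrite ?mem_enum.
  move=> i u mu ui; have := H i; rewrite mem_enum /= => /(_ isT).
  have [//|ngi] := boolP (guess_of w i).
  move: (ngi); rewrite /guess_of => -> /= /negP[].
  by apply/(step _ ngi); exists u.
apply/andP; split; first by apply/qeval_C_mod; exists v => // i _; apply: vj.
apply/allP => i _ /=; apply/implyP => ngi; apply/negP => /(step _ ngi)[u mu ui].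
by case/negP: ngi; apply: H ui.
Qed.

Definition entails n (T : dtheory A n) (g : 'I_n -> bool) f :=
  forall v, model T g (@con A) v -> feval v f.

(** The guess atoms are a parameter, so that one evaluation lemma covers both [Conseq_mod] and its
    renaming to primed guesses. *)
Definition conseq_with n (T : dtheory A n) (g : 'I_n -> gatom A) f :=
  qalls (qatoms (dtheory_var T ++ var f))
    (qImp (qAnd (qset (facts T))
                (qle [seq qVar x | x <- [seq g i | i <- enum 'I_n]]
                     [seq qform c | c <- [seq con (dflt T i) | i <- enum 'I_n]]))
          (qform f)).

Lemma Conseq_modE n (T : dtheory A n) f :
  Conseq_mod T f = conseq_with T (fun i => Guess (nat_of_ord i)) f.
Proof. by rewrite /conseq_with -[[seq qform c | c <- _]]map_comp. Qed.

Lemma qrename_qconj (B C : Type) (h : B -> C) (s : seq (qbf B)) :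
  qrename h (qconj s) = qconj [seq qrename h q | q <- s].
Proof. by elim: s => //= q s ->. Qed.

Lemma qrename_prime_qform (f : form A) :
  qrename (@prime_guess A) (qform f) = qform f.
Proof. by elim: f => //= [f ->|f -> g ->|f -> g ->|f -> g ->]. Qed.

Lemma qrename_Conseq_mod n (T : dtheory A n) f :
  qrename (@prime_guess A) (Conseq_mod T f) =
  conseq_with T (fun i => Guess' (nat_of_ord i)) f.
Proof.
rewrite Conseq_modE /conseq_with /qatoms /qset /qle.
elim: (undup _) => /= [|a s -> //].
rewrite !qrename_qconj !qrename_prime_qform; congr (qImp (qAnd (qconj _) (qconj _)) _).
  by rewrite -map_comp; apply: eq_map => c /=; rewrite qrename_prime_qform.
elim: (enum _) => //= i s ->; by rewrite qrename_prime_qform.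
Qed.

Lemma qeval_conseq_with n (T : dtheory A n) (g : 'I_n -> gatom A) f
    (w : gatom A -> bool) :
  (forall i a, g i <> Base a) ->
  qeval w (conseq_with T g f) <-> entails T (fun i => w (g i)) f.
Proof.
move=> gB; set P := dtheory_var T ++ var f.
have Pf : {subset var f <= P} by move=> a; rewrite mem_cat => ->; rewrite orbT.
have PT : {subset vars (facts T) <= P}.
  by move=> a; rewrite !mem_cat => ->; rewrite orbT.
have Pc i : {subset var (con (dflt T i)) <= P}.
  move=> a ac; rewrite /P /dtheory_var !mem_cat; do 2 (apply/orP; left).
  apply/flattenP; exists (default_var (dflt T i)).
    by apply/mapP; exists i; rewrite ?mem_enum.
  by rewrite /default_var !mem_cat ac !orbT.
rewrite /conseq_with -/P qeval_qalls; split=> [H v [vT vc]|H w' w'w].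
  have /= := H (overlay P v w) (@overlay_notin _ _ _).
  rewrite qeval_qset qeval_qle qeval_qform all_overlay // vT feval_overlay //=.
  move/implyP; apply; apply/allP => i _; apply/implyP.
  rewrite feval_overlay // => wi; apply: vc.
  by move: wi (gB i); case: (g i) => // a _ /(_ a).
rewrite /= qeval_qset qeval_qle qeval_qform.
apply/implyP => /andP[wT /allP wc]; apply: H; split=> // i wi.
have := wc i; rewrite mem_enum => /(_ isT) /implyP; apply.
by rewrite w'w //; apply/mapP => -[a _ /gB].
Qed.

Lemma qeval_qexs_guesses n (c : nat -> gatom A) (w : gatom A -> bool) Q
    (P : ('I_n -> bool) -> Prop) : injective c ->
  (forall u, qeval u Q <-> P (fun i => u (c (nat_of_ord i)))) ->
  qeval w (qexs [seq c (nat_of_ord i) | i <- enum 'I_n] Q) <-> exists g, P g.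
Proof.
move=> c_inj QP; rewrite qeval_qexs; split=> [[u _ /QP Pu]|[g Pg]].
  by eexists; exact: Pu.
(* The valuation reads [g] back through the injection [c] and keeps [w] on all other atoms. *)
exists (fun x => if [pick i : 'I_n | c i == x] is Some i then g i else w x).
  move=> x; case: pickP => // i /eqP <- /negP[].
  by rewrite (map_f (fun i : 'I_n => c i)) // mem_enum.
apply/QP; congr P: Pg; apply/funext => i; case: pickP => [j|/(_ i)].
  by move/eqP/c_inj/val_inj ->.
by rewrite eqxx.
Qed.

Lemma qeval_Conseq_mod n (T : dtheory A n) f (w : gatom A -> bool) :
  qeval w (Conseq_mod T f) <-> entails T (guess_of w) f.
Proof. by rewrite Conseq_modE; apply: qeval_conseq_with. Qed.

Lemma qeval_qrename_Conseq_mod n (T : dtheory A n) f (w : gatom A -> bool) :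
  qeval w (qrename (@prime_guess A) (Conseq_mod T f)) <->
  entails T (fun i => w (Guess' (nat_of_ord i))) f.
Proof. by rewrite qrename_Conseq_mod; apply: qeval_conseq_with. Qed.

Lemma qeval_Psi n (T : dtheory A n) (w : gatom A -> bool) :
  qeval w (Psi T) <->
  forall i : 'I_n, ~~ w (Guess' i) ->
    exists g, maxcons T g /\ ~ entails T g (con (dflt T i)).
Proof.
have step (i : 'I_n) : qeval w (qexs (guesses A n)
      (qAnd (Ext_mod T) (qNot (Conseq_mod T (con (dflt T i)))))) <->
    exists g, maxcons T g /\ ~ entails T g (con (dflt T i)).
  apply: (qeval_qexs_guesses (c := Guess)) => [j k [] //|u].
  by rewrite qeval_qAnd qeval_Ext_mod qeval_qNot qeval_Conseq_mod.
rewrite /Psi qeval_qconj all_map; split=> [/allP H i ni|H].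
  by apply/step; have := H i; rewrite mem_enum /= ni; apply.
by apply/allP => i _; apply/implyP => /H/step.
Qed.

Lemma entails_mono n (T : dtheory A n) (g h : 'I_n -> bool) f :
  (forall i, g i -> h i) -> entails T g f -> entails T h f.
Proof. by move=> gh H v [vT vh]; apply: H; split=> // i /gh /vh. Qed.

End Modules.

(** * Signed theories and derivability from consequents of defaults *)

Section Signed.
Variable Sigma : eqType.
Implicit Types (v w : satom Sigma -> bool) (q : Sigma) (s : seq Sigma).

Definition atom_of (a : satom Sigma) : Sigma :=
  match a with Orig q | Plus q | Minus q => q end.

Lemma eq_feval_signed_at v w b (f : form Sigma) :
  {in var f, forall q, v (Plus q) = w (Plus q) /\ v (Minus q) = w (Minus q)} ->
  feval v (signed_at b f) = feval w (signed_at b f).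
Proof.
elim: f b => [q|f IH|f IHf g IHg|f IHf g IHg|f IHf g IHg] b /= H;
  try by rewrite IHf ?IHg // => x xf; apply: H; rewrite mem_cat xf ?orbT.
- have [|vP vM] := H q; first by rewrite inE.
  by case: b; rewrite /= ?vP ?vM.
- by rewrite IH.
Qed.

Lemma eq_all_signed v w (W : seq (form Sigma)) :
  {in vars W, forall q, v (Plus q) = w (Plus q) /\ v (Minus q) = w (Minus q)} ->
  all (feval v) (signed_seq W) = all (feval w) (signed_seq W).
Proof.
elim: W => //= f W IH; rewrite /vars /= => H.
by rewrite /signed (@eq_feval_signed_at v w) ?IH // => q qf; apply: H;
  rewrite mem_cat qf ?orbT.
Qed.

(* Positive occurrences of p^+ and ~p^- become true, negative ones false. *)
Lemma feval_signed_at_true b (f : form Sigma) : feval xpredT (signed_at b f) = b.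
Proof.
by elim: f b => [q|f IH|f IHf g IHg|f IHf g IHg|f IHf g IHg] b /=;
  rewrite ?IH ?IHf ?IHg; case: b.
Qed.

Lemma all_signed_true (W : seq (form Sigma)) : all (feval xpredT) (signed_seq W).
Proof. by elim: W => //= f W ->; rewrite /signed feval_signed_at_true. Qed.

Lemma feval_jus v q : feval v (jus (delta q)) = (v (Plus q) == ~~ v (Minus q)).
Proof. by rewrite /=; case: (v (Plus q)); case: (v (Minus q)). Qed.

Lemma feval_con v q : feval v (con (delta q)) =
  (v (Orig q) == v (Plus q)) && (~~ v (Orig q) == v (Minus q)).
Proof.
by rewrite /=; case: (v (Orig q)); case: (v (Plus q)); case: (v (Minus q)).
Qed.

Lemma con_jus v q : feval v (con (delta q)) -> feval v (jus (delta q)).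
Proof.
rewrite feval_con feval_jus.
by case: (v (Orig q)); case: (v (Plus q)); case: (v (Minus q)).
Qed.

Lemma con_delta_inj q q' : con (delta q) = con (delta q') -> q = q'.
Proof. by case. Qed.

(** Off [s] this sets q and q^+ to true and q^- to false, which satisfies the consequent of every
    default there. *)
Definition fill s v (a : satom Sigma) : bool :=
  if atom_of a \in s then v a else if a is Minus _ then false else true.

Lemma fill_con s v q :
  (q \in s -> feval v (con (delta q))) -> feval (fill s v) (con (delta q)).
Proof. by rewrite !feval_con /fill /=; case: (q \in s) => // ->. Qed.

Lemma fill_signed s v (W : seq (form Sigma)) : {subset vars W <= s} ->
  all (feval (fill s v)) (signed_seq W) = all (feval v) (signed_seq W).
Proof. by move=> sub; apply: eq_all_signed => q /sub qs; rewrite /fill /= qs. Qed.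

Variable W : seq (form Sigma).

(* Only finitely many of the (possibly infinitely many) consequents matter:   *)
(* those of other atoms can be satisfied by changing the valuation off W, f.  *)
Lemma derives_con (X : Sigma -> Prop) f :
  derives (unionf (set_of_seq (signed_seq W))
                  (fun g => exists q, g = con (delta q) /\ X q)) f <->
  forall v, all (feval v) (signed_seq W) ->
    (forall q, X q -> feval v (con (delta q))) -> feval v f.
Proof.
split=> [d v /all_set_of_seq vW vX|H].
  by apply: derives_sound d _ => g [/vW //|[q [-> /vX]]].
pose s := vars W ++ map atom_of (var f).
pose L := [seq con (delta q) | q <- s & `[< X q >]].
apply: (@derives_mono _ (set_of_seq (signed_seq W ++ L))); last first.
  move=> g; elim: (signed_seq W) => [|h S IH] /=; last first.
    by case=> [->|/IH[]]; [left; left|left; right|right].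
  rewrite /L => Lg; right; elim: s {L H} Lg => //= q s IH.
  by case: asboolP => //= Xq [->|]; [exists q|apply: IH].
apply: derives_complete => v; rewrite all_cat => /andP[vW vL].
have <- : feval (fill s v) f = feval v f.
  apply: eq_feval_in => a af; rewrite /fill mem_cat.
  by rewrite (map_f atom_of af) orbT.
apply: H; first by rewrite fill_signed // => q; rewrite mem_cat => ->.
move=> q Xq; apply: fill_con => qs.
move: vL; rewrite all_map => /allP; apply.
by rewrite mem_filter qs andbT; apply/asboolP.
Qed.

Lemma signed_extE (E : fset (satom Sigma)) :
  signed_ext W E <->
  forall f, E f <-> derives (unionf (set_of_seq (signed_seq W)) (Pi E)) f.
Proof.
have H f : Gamma (@D_all Sigma) (set_of_seq (signed_seq W)) E f <->
    derives (unionf (set_of_seq (signed_seq W)) (Pi E)) f.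
  rewrite GammaE => [|d [q ->] //].
  split=> d; apply: derives_mono d _ => g [|]; try by left.
    by move=> [_ [[q ->] nE] ->]; right; exists q.
  by move=> [q [-> nE]]; right; exists (delta q) => //; split=> //; exists q.
by split=> ext f; have := ext f; rewrite H.
Qed.

(** * Extensions as maximal consistent choices of defaults over var(W) *)

Variables (n : nat) (p : 'I_n -> Sigma).
Hypotheses (p_inj : injective p) (p_enum : codom p =i vars W).
Let T := thy p W.

(** Extends a choice over var(W) to the whole alphabet, matching the fact that defaults of other
    atoms always apply. *)
Definition selected (g : 'I_n -> bool) q :=
  q \notin vars W \/ exists2 i, q = p i & g i.

Lemma p_vars i : p i \in vars W.
Proof. by rewrite -p_enum codom_f. Qed.

Lemma selected_p g i : selected g (p i) <-> g i.
Proof.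
split=> [[|[j /p_inj -> //]]|gi]; first by rewrite p_vars.
by right; exists i.
Qed.

(** Each original atom copies q^+. Signed formulas do not mention original atoms, so W^± keeps its
    truth value, while on var(W) a satisfied justification becomes a satisfied consequent. *)
Definition normal v (a : satom Sigma) : bool :=
  if a is Orig q then fill (vars W) v (Plus q) else fill (vars W) v a.

Lemma normal_signed v :
  all (feval (normal v)) (signed_seq W) = all (feval v) (signed_seq W).
Proof. by apply: eq_all_signed => q qs; rewrite /normal /fill /= qs. Qed.

Lemma normal_con v q : (q \in vars W -> feval v (jus (delta q))) ->
  feval (normal v) (con (delta q)).
Proof.
rewrite feval_con feval_jus /normal /fill /=.
case: (q \in vars W) => // /(_ isT) /eqP ->.
by case: (v (Minus q)).
Qed.

Lemma normal_selected g v q : model T g (@jus _) v -> selected g q ->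
  feval (normal v) (con (delta q)).
Proof.
move=> [vW vg] [qW|[i -> gi]]; apply: normal_con; first by rewrite (negbTE qW).
by move=> _; apply: vg.
Qed.

Lemma ext_selected E : signed_ext W E ->
  exists2 g, maxcons T g & forall q, ~ E (Not (jus (delta q))) <-> selected g q.
Proof.
move=> /signed_extE extE.
(* The fixpoint equation in semantic form: a default applies iff its justification is satisfiable
   together with W^± and all applied consequents. *)
have En q : ~ E (Not (jus (delta q))) <-> exists v,
    [/\ all (feval v) (signed_seq W),
        forall q, ~ E (Not (jus (delta q))) -> feval v (con (delta q)) &
        feval v (jus (delta q))].
  rewrite extE derives_con; split=> [nH|[v [vW vE vq]] H].
    apply: contrapT => nex; apply: nH => v vW vE.
    by apply/negP => vq; apply: nex; exists v.
  by have /negP := H v vW vE.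
(* Any applied default supplies such a model through [En]; if none applies, the all-true valuation
   satisfies W^±. *)
have [v0 v0W v0E] : exists2 v, all (feval v) (signed_seq W) &
    forall q, ~ E (Not (jus (delta q))) -> feval v (con (delta q)).
  have [[q /En[v [vW vE _]]]|none] :=
    pselect (exists q, ~ E (Not (jus (delta q)))); first by exists v.
  by exists xpredT => [|q nE]; [exact: all_signed_true|case: none; exists q].
pose g i : bool := `[< ~ E (Not (jus (delta (p i)))) >].
have offW q : q \notin vars W -> ~ E (Not (jus (delta q))).
  move=> qW; apply/En; exists (fill (vars W) v0); split.
  - by rewrite fill_signed.
  - by move=> q' /v0E v0q'; apply: fill_con.
  - by apply/con_jus/fill_con; rewrite (negbTE qW).
have selE q : ~ E (Not (jus (delta q))) <-> selected g q.
  split=> [nE|[/offW //|[i -> /asboolP //]]].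
  have [qW|] := boolP (q \in vars W); last by left.
  move: (qW); rewrite -p_enum => /codomP[i qi]; right; exists i => //.
  by apply/asboolP; rewrite -qi.
exists g => //; split.
  by exists v0; split=> // i /asboolP /v0E /con_jus.
(* Normalising a model of the chosen justifications satisfies all applied consequents, so a further
   satisfied justification makes its default apply. *)
move=> i v mv vi; apply/asboolP/En; exists (normal v); split.
- by rewrite normal_signed; case: mv.
- by move=> q /selE; apply: normal_selected.
- by apply/con_jus/normal_con.
Qed.

(** [E] is the closure of W^± with the selected consequents. No other default applies, by maximality
    of [g]; every selected one does, because the normalised model of [g] satisfies its
    justification. *)
Lemma selected_ext g : maxcons T g ->
  exists2 E, signed_ext W E & forall q, ~ E (Not (jus (delta q))) <-> selected g q.
Proof.
move=> [[v0 mv0] gmax].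
pose E := derives (unionf (set_of_seq (signed_seq W))
                  (fun f => exists q, f = con (delta q) /\ selected g q)).
have selE q : ~ E (Not (jus (delta q))) <-> selected g q.
  rewrite /E derives_con; split=> [nH|sel H].
    apply: contrapT => nsel; apply: nH => v vW vsel; apply/negP => vq.
    apply: nsel; have [|] := boolP (q \in vars W); last by left.
    rewrite -p_enum => /codomP[i qi]; right; exists i => //.
    apply: (gmax _ v); last by rewrite /= -qi.
    by split=> // j gj; apply/con_jus/vsel; right; exists j.
  have mv q' : selected g q' -> feval (normal v0) (con (delta q')).
    exact: normal_selected.
  have vW : all (feval (normal v0)) (signed_seq W).
    by rewrite normal_signed; case: mv0.
  by have /negP := H _ vW mv; apply; apply/con_jus/mv.
exists E => //; apply/signed_extE => f.
by split=> d; apply: derives_mono d _ => h [|[q [-> /selE]]];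
  [left|right; exists q|left|right; exists q].
Qed.

(** The empty choice is consistent by the all-true valuation, so a maximal one exists by finiteness.
    This provides an extension. *)
Lemma maxcons_exists : exists g, maxcons T g.
Proof.
pose P (Y : {set 'I_n}) := `[< exists v, model T (mem Y) (@jus _) v >].
have P0 : P set0.
  apply/asboolP; exists xpredT; split; first exact: all_signed_true.
  by move=> i; rewrite /= inE.
have [Y /maxsetP[/asboolP PY maxY] _] := maxset_exists P0.
exists (mem Y); split=> // i v [vW vY] vi.
rewrite /= -(maxY (i |: Y)) ?setU11 ?subsetUr //.
apply/asboolP; exists v; split=> // j; rewrite /= !inE => /orP[/eqP -> //|].
exact: vY.
Qed.

(** Lets [Psi] detect a missing default by non-entailment of its consequent. The normalised model of
    [g] satisfies the chosen consequents; if they entail that of [i], it satisfies the justification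
    of [i] too, and maximality puts [i] in [g]. *)
Lemma entails_dflt g i : maxcons T g -> entails T g (con (dflt T i)) <-> g i.
Proof.
move=> [[v mv] gmax]; split=> [H|gi u [_]]; last exact.
apply: (gmax _ (normal v)).
  split=> [|j gj]; first by rewrite /= normal_signed; case: mv.
  by apply: con_jus; apply: (normal_selected mv); right; exists j.
apply: con_jus; apply: H; split; first by rewrite /= normal_signed; case: mv.
by move=> j gj; apply: (normal_selected mv); right; exists j.
Qed.

(** * The three consequence relations in terms of maximal choices *)

Variable phi : form Sigma.
Let T' := thy' p W phi.

(** Of the infinitely many possible consequents outside var(W), only those for atoms of [phi]
    constrain its value, and these are the facts added in [T']; [fill] satisfies the rest. *)
Lemma derives_selected g :
  derives (unionf (set_of_seq (signed_seq W))
                  (fun f => exists q, f = con (delta q) /\ selected g q))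
    (signed phi) <-> entails T' g (signed phi).
Proof.
rewrite derives_con; split=> [H v [vT vg]|H v vW vsel]; last first.
  apply: H; split=> [|i gi]; last by apply: vsel; right; exists i.
  rewrite /= all_cat vW all_map; apply/allP => q.
  by rewrite mem_filter => /andP[qW _]; apply: vsel; left.
move: vT; rewrite /= all_cat all_map => /andP[vW /allP vphi].
pose s := vars W ++ var phi.
have <- : feval (fill s v) (signed phi) = feval v (signed phi).
  by apply: eq_feval_signed_at => q qphi; rewrite /fill /= mem_cat qphi orbT.
apply: H; first by rewrite fill_signed // => q; rewrite mem_cat => ->.
move=> q [qW|[i -> gi]]; apply: fill_con => qs; last exact: vg.
apply: vphi; rewrite mem_filter qW mem_undup.
by move: qs; rewrite mem_cat (negbTE qW).
Qed.

Lemma derives_Pi E g :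
  (forall q, ~ E (Not (jus (delta q))) <-> selected g q) ->
  Cn (unionf (set_of_seq (signed_seq W)) (Pi E)) (signed phi) <->
  entails T' g (signed phi).
Proof.
move=> selE; rewrite -derives_selected.
by split=> d; apply: derives_mono d _ => h [|[q [-> /selE]]];
  [left|right; exists q|left|right; exists q].
Qed.

Lemma cred_conseqE : cred_conseq W phi <->
  exists2 g, maxcons T g & entails T' g (signed phi).
Proof.
split=> [[E [/ext_selected[g mg selE] /(derives_Pi selE)]]|[g mg H]].
  by exists g.
by have [E extE selE] := selected_ext mg; exists E; split=> //; apply/(derives_Pi selE).
Qed.

Lemma skep_conseqE : skep_conseq W phi <->
  forall g, maxcons T g -> entails T' g (signed phi).
Proof.
split=> [H g mg|H E extE].
  have [E extE selE] := selected_ext mg; apply/(derives_Pi selE); exact: H.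
by have [g mg selE] := ext_selected extE; apply/(derives_Pi selE); apply: H.
Qed.

Definition common (i : 'I_n) : bool := `[< forall g, maxcons T g -> g i >].

Lemma prud_conseqE : prud_conseq W phi <-> entails T' common (signed phi).
Proof.
rewrite -derives_selected /prud_conseq.
have eqS f : (forall E, signed_ext W E -> Pi E f) <->
    (exists q, f = con (delta q) /\ selected common q).
  split=> [H|[q [-> sel]] E extE]; last first.
    exists q; split=> //; have [g mg selE] := ext_selected extE; apply/selE.
    by case: sel => [|[i -> /asboolP/(_ g mg) gi]]; [left|right; exists i].
  (* Some extension is needed here: an intersection over no extensions would contain every
     formula. *)
  have [g0 mg0] := maxcons_exists; have [E0 extE0 _] := selected_ext mg0.
  have [q [fq _]] := H _ extE0; exists q; split=> //.
  have [|] := boolP (q \in vars W); last by left.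
  rewrite -p_enum => /codomP[i qi]; right; exists i => //.
  apply/asboolP => g mg; have [E extE selE] := selected_ext mg.
  (* Another extension may name its own atom for the same consequent; injectivity identifies it with
     [q]. *)
  have [q' []] := H _ extE; rewrite fq => /con_delta_inj <-.
  by rewrite selE qi selected_p.
by split=> d; apply: derives_mono d _ => h [|/eqS]; by [left|right].
Qed.

End Signed.

(** * The QBF characterisations *)

Theorem theorem9 (Sigma : eqType) (W : seq (form Sigma)) (phi : form Sigma)
    (n : nat) (p : 'I_n -> Sigma)
    (p_inj : injective p) (p_enum : codom p =i vars W) :
  let T := thy p W in
  let T' := thy' p W phi in
  let G := guesses (satom Sigma) n in
  let G' := guesses' (satom Sigma) n in
  [/\ cred_conseq W phi <->
        qvalid (qexs G (qAnd (Ext_mod T) (Conseq_mod T' (signed phi)))),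
      skep_conseq W phi <->
        qvalid (qNot (qexs G
          (qAnd (Ext_mod T) (qNot (Conseq_mod T' (signed phi))))))
    & prud_conseq W phi <->
        qvalid (qNot (qexs G'
          (qAnd (Psi T)
             (qNot (qrename (@prime_guess (satom Sigma))
                            (Conseq_mod T' (signed phi)))))))].
Proof.
move=> T T' G G'.
have guess_inj : injective (@Guess (satom Sigma)) by move=> j k [].
have guess'_inj : injective (@Guess' (satom Sigma)) by move=> j k [].
have neg_iff q : qvalid (qNot q) <->
    forall w : gatom (satom Sigma) -> bool, ~ qeval w q.
  by split=> H w; apply/qeval_qNot; apply: H.
split.
- rewrite (cred_conseqE p_enum).
  have key w : qeval w (qexs G (qAnd (Ext_mod T) (Conseq_mod T' (signed phi))))
      <-> exists g, maxcons T g /\ entails T' g (signed phi).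
    apply: (qeval_qexs_guesses (c := Guess)) => // u.
    by rewrite qeval_qAnd qeval_Ext_mod qeval_Conseq_mod.
  (* The condition in [key] does not depend on [w], so validity can be tested at the arbitrary
     valuation [xpredT]. *)
  split=> [[g mg Hg] w|/(_ xpredT)/key[g [mg Hg]]]; last by exists g.
  by apply/key; exists g.
- rewrite (skep_conseqE p_enum) neg_iff.
  have key w : qeval w (qexs G (qAnd (Ext_mod T)
        (qNot (Conseq_mod T' (signed phi)))))
      <-> exists g, maxcons T g /\ ~ entails T' g (signed phi).
    apply: (qeval_qexs_guesses (c := Guess)) => // u.
    by rewrite qeval_qAnd qeval_Ext_mod qeval_qNot qeval_Conseq_mod.
  split=> [H w /key[g [/H]] //|H g mg]; apply: contrapT => nHg.
  by apply: (H xpredT); apply/key; exists g.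
- rewrite (prud_conseqE p_inj p_enum) neg_iff.
  have key w : qeval w (qexs G' (qAnd (Psi T)
        (qNot (qrename (@prime_guess (satom Sigma))
                       (Conseq_mod T' (signed phi))))))
      <-> exists g : 'I_n -> bool, (forall i, common W p i -> g i) /\
                    ~ entails T' g (signed phi).
    apply: (qeval_qexs_guesses (c := Guess')) => // u.
    rewrite qeval_qAnd qeval_Psi qeval_qNot qeval_qrename_Conseq_mod.
    (* By [entails_dflt], [Psi] says that each default left out of [g] is missing from some maximal
       choice; contraposition gives inclusion of [common] in [g]. *)
    split=> -[H nC]; split=> // i.
      move=> /asboolP ci; apply/negPn/negP => /H[g [mg]]; apply.
      by apply/(entails_dflt i mg)/ci.
    move=> ni; apply: contrapT => nex; move/negP: ni; apply; apply: H.
    apply/asboolP => g mg; apply/negPn/negP => /negP ngi.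
    by apply: nex; exists g; split=> // /(entails_dflt i mg).
  (* [common] is the least admissible [g]: entailment from it passes upwards, and if it fails there,
     [common] is itself a counterexample. *)
  split=> [H w /key[g [cg]]|H]; first by apply; apply: entails_mono H.
  apply: contrapT => nH; apply: (H xpredT); apply/key.
  by exists (common W p).
Qed.
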